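(* For all integers $d\ge 1$ and $n\ge 1$, $$D_{d,n}(q_0,\ldots,q_n;w)=\left(\prod_{k=0}^{n-1}\frac{F_d(Q_kw^{dk},w)}{(1-Q_kw^{dk})(1-Q_kw^{dk+1})\cdots(1-Q_kw^{dk+d})}\right)\frac{1}{1-Q_nw^{dn}},$$ where $Q_k:=q_0q_1\cdots q_k$ for all $k\ge0$, $D_{d,n}$ is the generating function of $d$-fold partition diamonds of length $n$, and $F_d$ is the recursively defined polynomial, both as defined in the context.
   Context: For integers $d,n\ge1$, define the generating function (a formal power series in the indeterminates $q_0,\ldots,q_n,w$) $$D_{d,n}(q_0,q_1,\ldots,q_n;w):=\sum q_0^{a_0}\cdots q_n^{a_n}\,w^{\sum_{j=1}^n\sum_{k=1}^d b_{j,k}},$$ where the outer sum ranges over all non-negative integers $a_i$ ($0\le i\le n$) and $b_{j,k}$ ($1\le j\le n$, $1\le k\le d$) satisfying $a_{j-1}\ge b_{j,k}\ge a_j$ for all $1\le j\le n$ and $1\le k\le d$. The polynomials $F_d(q_0,w)\in\mathbb{Z}[q_0,w]$ ($d\ge1$) are defined by $F_1(q_0,w)=1$ and, for $d\ge2$, $$F_d(q_0,w)=\frac{(1-q_0w^d)F_{d-1}(q_0,w)-w(1-q_0)F_{d-1}(q_0w,w)}{1-w}$$ (the numerator is divisible by $1-w$, so this is a polynomial). *)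

(* Defs.v *)
From HB Require Import structures.
From mathcomp Require Import all_boot all_order all_algebra.
From mathcomp Require Import boolp classical_sets cardinality fsbigop.
From mathcomp Require Import mpoly.

Set Implicit Arguments.
Unset Strict Implicit.
Unset Printing Implicit Defensive.

Import GRing.Theory.

Local Open Scope ring_scope.

Record fps (n : nat) (R : Type) := FPS { fcoef : 'X_{1..n} -> R }.

Section FpsRing.
Variables (n : nat) (R : comNzRingType).
Implicit Types (f g h : fps n R) (m : 'X_{1..n}).

Lemma fpsP f g : (forall m, fcoef f m = fcoef g m) <-> f = g.
Proof.
split=> [|-> //]; case: f g => [f] [g] /= e.
by congr FPS; apply: funext.
Qed.

HB.instance Definition _ := gen_eqMixin (fps n R).
HB.instance Definition _ := gen_choiceMixin (fps n R).

Definition fps_add f g := FPS (fun m => fcoef f m + fcoef g m).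
Definition fps_opp f := FPS (fun m => - fcoef f m).
Definition fps_monom m : fps n R := FPS (fun k => (k == m)%:R).

(* Same shape as the product of {mpoly R[n]} (cf. mcoeffM): the bounds only
   serve to make the set of decompositions m = k.1 + k.2 a finite type. *)
Definition fps_mul f g := FPS (fun m =>
  \sum_(k : 'X_{1..n < (mdeg m).+1, (mdeg m).+1} | m == (k.1 + k.2)%MM)
     fcoef f k.1 * fcoef g k.2).

Fact fps_addA : associative fps_add.
Proof. by move=> f g h; apply/fpsP => m /=; rewrite addrA. Qed.
Fact fps_addC : commutative fps_add.
Proof. by move=> f g; apply/fpsP => m /=; rewrite addrC. Qed.
Fact fps_add0 : left_id (FPS (fun=> 0)) fps_add.
Proof. by move=> f; apply/fpsP => m /=; rewrite add0r. Qed.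
Fact fps_addN : left_inverse (FPS (fun=> 0)) fps_opp fps_add.
Proof. by move=> f; apply/fpsP => m /=; rewrite addNr. Qed.

HB.instance Definition _ :=
  GRing.isZmodule.Build (fps n R) fps_addA fps_addC fps_add0 fps_addN.

(* The ring axioms are transported from {mpoly R[n]} along truncation. *)
Definition ftrunc b f : {mpoly R[n]} :=
  \sum_(k : 'X_{1..n < b}) fcoef f k *: 'X_[k].

Lemma mcoeff_ftrunc b f m :
  (ftrunc b f)@_m = if (mdeg m < b)%N then fcoef f m else 0.
Proof.
rewrite /ftrunc raddf_sum /=; case: ifP => [lt_mb | ge_mb].
  rewrite (bigD1 (BMultinom lt_mb)) //= mcoeffZ mcoeffX eqxx mulr1.
  rewrite big1 ?addr0 // => k /negPf; rewrite -val_eqE /= => ne_km.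
  by rewrite mcoeffZ mcoeffX ne_km mulr0.
rewrite big1 // => k _; rewrite mcoeffZ mcoeffX; case: eqP => [e|]; last first.
  by rewrite mulr0.
by move: ge_mb; rewrite -e bmdeg.
Qed.

Lemma mdeg_decomp m (k1 k2 : 'X_{1..n}) :
  m = (k1 + k2)%MM -> (mdeg k1 <= mdeg m)%N * (mdeg k2 <= mdeg m)%N.
Proof. by move=> ->; rewrite mdegD leq_addr leq_addl. Qed.

Lemma mdeg_decomp_lt m (k1 k2 : 'X_{1..n}) :
  m = (k1 + k2)%MM -> k1 != 0%MM -> (mdeg k2 < mdeg m)%N.
Proof.
by move=> -> k1_0; rewrite mdegD -[ltnLHS]add0n ltn_add2r lt0n mdeg_eq0.
Qed.

Lemma eq_mcoeffM (p q p' q' : {mpoly R[n]}) m :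
    (forall k, (mdeg k <= mdeg m)%N -> p@_k = p'@_k) ->
    (forall k, (mdeg k <= mdeg m)%N -> q@_k = q'@_k) ->
  (p * q)@_m = (p' * q')@_m.
Proof.
move=> ep eq; rewrite !mcoeffM; apply: eq_bigr => k /eqP /mdeg_decomp [k1 k2].
by rewrite ep ?eq.
Qed.

Lemma fcoef_mulE b f g m : (mdeg m < b)%N ->
  fcoef (fps_mul f g) m = (ftrunc b f * ftrunc b g)@_m.
Proof.
move=> lt_mb; rewrite mcoeffM /=; apply: eq_bigr => k /eqP /mdeg_decomp [k1 k2].
by rewrite !mcoeff_ftrunc (leq_ltn_trans k1) ?(leq_ltn_trans k2).
Qed.

Lemma fps_mulA : associative fps_mul.
Proof.
move=> f g h; apply/fpsP => m; rewrite !(@fcoef_mulE (mdeg m).+1) //.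
transitivity ((ftrunc (mdeg m).+1 f *
               (ftrunc (mdeg m).+1 g * ftrunc (mdeg m).+1 h))@_m).
  apply: eq_mcoeffM => // k le_km.
  by rewrite mcoeff_ftrunc ltnS le_km (@fcoef_mulE (mdeg m).+1).
rewrite mulrA; apply: eq_mcoeffM => // k le_km.
by rewrite mcoeff_ftrunc ltnS le_km (@fcoef_mulE (mdeg m).+1).
Qed.

Lemma fps_mulC : commutative fps_mul.
Proof.
by move=> f g; apply/fpsP => m; rewrite !(@fcoef_mulE (mdeg m).+1) // mulrC.
Qed.

Lemma fps_mul1 : left_id (fps_monom 0%MM) fps_mul.
Proof.
move=> f; apply/fpsP => m; rewrite (@fcoef_mulE (mdeg m).+1) //.
transitivity ((1 * ftrunc (mdeg m).+1 f)@_m).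
  apply: eq_mcoeffM => // k le_km.
  by rewrite mcoeff_ftrunc ltnS le_km mcoeff1.
by rewrite mul1r mcoeff_ftrunc ltnSn.
Qed.

Lemma fps_mulDl : left_distributive fps_mul fps_add.
Proof.
move=> f g h; apply/fpsP => m /=; rewrite -big_split /=.
by apply: eq_bigr => k _; rewrite mulrDl.
Qed.

Lemma fps_oner_neq0 : fps_monom 0%MM != 0.
Proof.
apply/eqP => /fpsP /(_ 0%MM) /=; rewrite eqxx => /eqP.
by rewrite oner_eq0.
Qed.

HB.instance Definition _ := GRing.Zmodule_isComNzRing.Build (fps n R)
  fps_mulA fps_mulC fps_mul1 fps_mulDl fps_oner_neq0.

(* f^-1 is the (unique) multiplicative inverse of f when there is one, and f
   otherwise, as for every unitRingType. *)
Definition fps_unit : pred (fps n R) := fun f => `[< exists g, g * f = 1 >].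
Definition fps_inv f : fps n R := xget f [set g | g * f = 1]%classic.

Fact fps_mulVr : {in fps_unit, left_inverse 1 fps_inv *%R}.
Proof.
move=> f /asboolP [g gf]; rewrite /fps_inv.
by case: xgetP => [h _ //|/(_ g)].
Qed.
Fact fps_unitP f g : g * f = 1 -> fps_unit f.
Proof. by move=> gf; apply/asboolP; exists g. Qed.
Fact fps_inv_out : {in [predC fps_unit], fps_inv =1 id}.
Proof.
move=> f; rewrite inE => /asboolP nf; rewrite /fps_inv.
by case: xgetP => [h _ /= hf|//]; case: nf; exists h.
Qed.

HB.instance Definition _ := GRing.ComNzRing_hasMulInverse.Build (fps n R)
  fps_mulVr fps_unitP fps_inv_out.

Lemma fcoefD f g m : fcoef (f + g) m = fcoef f m + fcoef g m.
Proof. by []. Qed.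
Lemma fcoefN f m : fcoef (- f) m = - fcoef f m.
Proof. by []. Qed.
Lemma fcoef0 m : fcoef (0 : fps n R) m = 0.
Proof. by []. Qed.
Lemma fcoef1 m : fcoef (1 : fps n R) m = (m == 0%MM)%:R.
Proof. by []. Qed.
Lemma fcoefM f g m : fcoef (f * g) m =
  \sum_(k : 'X_{1..n < (mdeg m).+1, (mdeg m).+1} | m == (k.1 + k.2)%MM)
     fcoef f k.1 * fcoef g k.2.
Proof. by []. Qed.

Lemma eq_fcoefM f f' g g' m :
    (forall k, (mdeg k <= mdeg m)%N -> fcoef f k = fcoef f' k) ->
    (forall k, (mdeg k <= mdeg m)%N -> fcoef g k = fcoef g' k) ->
  fcoef (f * g) m = fcoef (f' * g') m.
Proof.
move=> ef eg; rewrite !fcoefM; apply: eq_bigr => k /eqP /mdeg_decomp [k1 k2].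
by rewrite ef ?eg.
Qed.

Lemma fcoefX_small f b m :
  fcoef f 0%MM = 0 -> (mdeg m < b)%N -> fcoef (f ^+ b) m = 0.
Proof.
move=> f0; elim: b m => [|b IHb] m // lt_mb.
rewrite exprS fcoefM big1 // => k /eqP em.
have [k1_0|k1_0] := eqVneq (bmnm k.1) 0%MM; first by rewrite k1_0 f0 mul0r.
by rewrite IHb ?mulr0 // -ltnS (leq_trans _ lt_mb) // ltnS (mdeg_decomp_lt em).
Qed.

Lemma fps_unit1 f : fcoef f 0%MM = 1 -> f \is a GRing.unit.
Proof.
move=> f0; pose h := 1 - f.
have h0 : fcoef h 0%MM = 0 by rewrite fcoefD fcoefN fcoef1 eqxx f0 subrr.
pose G b := \sum_(i < b) h ^+ i.
have stab m a : fcoef (G ((mdeg m).+1 + a)%N) m = fcoef (G (mdeg m).+1) m.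
  elim: a => [|a IHa]; first by rewrite addn0.
  rewrite addnS /G big_ord_recr fcoefD -/(G _) IHa fcoefX_small ?addr0 //.
  by rewrite addSn ltnS leq_addr.
suff: FPS (fun m => fcoef (G (mdeg m).+1) m) * f = 1 by move/fps_unitP.
apply/fpsP => m; transitivity (fcoef (G (mdeg m).+1 * f) m).
  apply: eq_fcoefM => // k le_km /=.
  by rewrite -(subnKC le_km) -addSn stab.
have -> : f = 1 - h by rewrite /h opprB addrC subrK.
rewrite -[G _ * _]opprK -mulrN opprB mulrC -subrX1 opprB.
by rewrite fcoefD fcoefN fcoefX_small // subr0.
Qed.

Definition fps_var (i : 'I_n) : fps n R := fps_monom U_(i)%MM.

(* The sum of a family of power series is taken coefficientwise: it is
   meaningful when, for every m, only finitely many members of the family have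
   a nonzero coefficient at m (\sum_(i \in P) is the finitely supported sum). *)
Definition fps_sum (I : choiceType) (P : set I) (F : I -> fps n R) : fps n R :=
  FPS (fun m => \sum_(i \in P) fcoef (F i) m).

Lemma fps_monomD m1 m2 : fps_monom (m1 + m2)%MM = fps_monom m1 * fps_monom m2.
Proof.
apply/fpsP => m; rewrite (@fcoef_mulE (mdeg m).+1) //.
transitivity ((('X_[m1] : {mpoly R[n]}) * 'X_[m2])@_m).
  by rewrite -mpolyXD mcoeffX eq_sym.
apply: eq_mcoeffM => k le_km;
  by rewrite mcoeff_ftrunc ltnS le_km mcoeffX eq_sym.
Qed.

Lemma fps_monom_prod (I : finType) (m : I -> 'X_{1..n}) :
  fps_monom (\big[+%MM/0%MM]_i m i)%MM = \prod_i fps_monom (m i).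
Proof. exact: (big_morph _ fps_monomD). Qed.

Lemma fps_monomX m k : fps_monom (m *+ k)%MM = fps_monom m ^+ k.
Proof.
elim: k => [|k IHk]; first by rewrite mulm0n.
by rewrite mulmS fps_monomD IHk exprS.
Qed.

End FpsRing.

Section Diamonds.
Variables d n : nat.

(* The indeterminates are numbered q_0, ..., q_n, w. *)
Definition qvar (i : nat) : fps n.+2 int := fps_var int (inord i).
Definition wvar : fps n.+2 int := fps_var int ord_max.

Definition Qvar (k : nat) : fps n.+2 int := \prod_(i < k.+1) qvar i.

(* An index j : 'I_n stands for j + 1 in {1, ..., n}, so that
   widen_ord (leqnSn n) j and lift ord0 j are the indices j - 1 and j of the
   sequence a_0, ..., a_n; similarly k : 'I_d stands for k + 1. *)
Definition is_diamond
    (ab : {ffun 'I_n.+1 -> nat} * {ffun 'I_n * 'I_d -> nat}) : Prop :=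
  forall (j : 'I_n) (k : 'I_d),
    (ab.2 (j, k) <= ab.1 (widen_ord (leqnSn n) j))%N /\
    (ab.1 (lift ord0 j) <= ab.2 (j, k))%N.

Definition diamond_weight
    (ab : {ffun 'I_n.+1 -> nat} * {ffun 'I_n * 'I_d -> nat}) : fps n.+2 int :=
  (\prod_(i < n.+1) qvar i ^+ ab.1 i) *
  wvar ^+ (\sum_(j < n) \sum_(k < d) ab.2 (j, k))%N.

Lemma diamond_weightE ab : diamond_weight ab =
  fps_monom int ((\big[+%MM/0%MM]_(i < n.+1) (U_(inord i) *+ ab.1 i)) +
                 U_(ord_max) *+ (\sum_(j < n) \sum_(k < d) ab.2 (j, k)))%MM.
Proof.
rewrite fps_monomD fps_monom_prod fps_monomX; congr (_ * _).
by apply: eq_bigr => i _; rewrite fps_monomX.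
Qed.

Lemma diamond_summable (m : 'X_{1..n.+2}) :
  finite_set [set ab | fcoef (diamond_weight ab) m != 0]%classic.
Proof.
pose b := (mdeg m).+1.
pose f (x : {ffun 'I_n.+1 -> 'I_b} * {ffun 'I_n * 'I_d -> 'I_b}) :=
  ([ffun i => val (x.1 i)] : {ffun 'I_n.+1 -> nat},
   [ffun jk => val (x.2 jk)] : {ffun 'I_n * 'I_d -> nat}).
apply: (@sub_finite_set _ _ (f @` setT)%classic); last first.
  exact/finite_image/finite_finset.
move=> [x y]; rewrite /mkset diamond_weightE /=; case: (m =P _) => [em _|_]; last first.
  by rewrite eqxx.
have dm : mdeg m = (\sum_(i < n.+1) x i + \sum_(j < n) \sum_(k < d) y (j, k))%N.
  rewrite em mdegD mdegMn mdeg1 mul1n mdeg_sum; congr (_ + _)%N.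
  by apply: eq_bigr => i _; rewrite mdegMn mdeg1 mul1n.
have xb i : (x i < b)%N.
  by rewrite ltnS dm (bigD1 i) //= -!addnA leq_addr.
have yb jk : (y jk < b)%N.
  case: jk => j k; rewrite ltnS dm (bigD1 j) //= (bigD1 k) //=.
  by rewrite -!addnA addnCA leq_addr.
exists ([ffun i => Ordinal (xb i)], [ffun jk => Ordinal (yb jk)]) => //.
by rewrite /f /=; congr pair; apply/ffunP => i; rewrite !ffunE.
Qed.

Definition Dgf : fps n.+2 int :=
  fps_sum [set ab | is_diamond ab]%classic diamond_weight.

End Diamonds.

(* Z[q_0, w] is represented as {poly {poly int}}, with outer indeterminate w
   and inner indeterminate q_0. *)
Definition biv_eval (S : comNzRingType) (p : {poly {poly int}}) (q w : S) : S :=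
  (map_poly (fun c : {poly int} => (map_poly intr c).[q]) p).[w].

Definition Fnum (d : nat) (F : {poly {poly int}}) : {poly {poly int}} :=
  let q := 'X%:P in let w := 'X in
  (1 - q * w ^+ d) * biv_eval F q w - w * (1 - q) * biv_eval F (q * w) w.

(* The value at 0 is irrelevant.  The divisor 1 - w has an invertible leading
   coefficient in Z[q_0], so %/ is Euclidean division. *)
Fixpoint Fpoly (d : nat) : {poly {poly int}} :=
  match d with
  | 0 | 1 => 1
  | d'.+1 => Fnum d (Fpoly d') %/ (1 - 'X)
  end.

Lemma biv_evalE (S : comNzRingType) (p : {poly {poly int}}) (q w : S) :
  biv_eval p q w = \sum_(i < size p) \sum_(j < size p`_i)
                     (p`_i`_j)%:~R * q ^+ j * w ^+ i.
Proof.
rewrite /biv_eval /map_poly horner_poly; apply: eq_bigr => i _.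
by rewrite horner_poly mulr_suml.
Qed.

Lemma biv_eval_id p : biv_eval p ('X%:P) 'X = p.
Proof.
rewrite biv_evalE -[RHS]coefK poly_def; apply: eq_bigr => i _.
rewrite -mulr_suml -mul_polyC; congr (_ * _).
rewrite -[p`_i in RHS]coefK poly_def rmorph_sum /=; apply: eq_bigr => j _.
by rewrite -mul_polyC rmorphM rmorphXn /= -[(_`_j in RHS)]intz !rmorph_int.
Qed.

Lemma rmorph_biv_eval (S T : comNzRingType) (phi : {rmorphism S -> T})
    p (q w : S) :
  phi (biv_eval p q w) = biv_eval p (phi q) (phi w).
Proof.
rewrite !biv_evalE rmorph_sum; apply: eq_bigr => i _; rewrite rmorph_sum /=.
by apply: eq_bigr => j _; rewrite !rmorphM !rmorphXn rmorph_int.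
Qed.

Lemma Fpoly1 : Fpoly 1 = 1. Proof. by []. Qed.

Lemma Fnum_root d F : root (Fnum d F) 1.
Proof.
rewrite /root -[_.[_]]/(horner_eval 1 _) rmorphB !rmorphM !rmorphB !rmorphM.
rewrite rmorphXn !rmorph_biv_eval rmorphM rmorph1 /= /horner_eval !hornerE.
by rewrite expr1n !mulr1 subrr.
Qed.

Lemma FpolyS d : (0 < d)%N ->
  (1 - 'X) * Fpoly d.+1 = Fnum d.+1 (Fpoly d).
Proof.
case: d => // d _; have -> : Fpoly d.+2 = Fnum d.+2 (Fpoly d.+1) %/ (1 - 'X).
  by [].
have u : lead_coef (1 - 'X : {poly {poly int}}) \is a GRing.unit.
  by rewrite -opprB lead_coefN lead_coefXsubC rpredN unitr1.
by rewrite (Pdiv.IdomainUnit.divpKC u) // -dvdpNl opprB dvdp_XsubCl Fnum_root.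
Qed.

(* Main.v *)
Require Import Defs.
From mathcomp Require Import all_boot all_order all_algebra.
From mathcomp Require Import classical_sets fsbigop.
From mathcomp Require Import mpoly ring zify.
Import GRing.Theory.
Local Open Scope ring_scope.

(** A diamond is determined by its consecutive drops: put e_i = a_i - a_(i+1)
    for i < n, e_n = a_n, and c_(j,k) = b_(j,k) - a_j.  The drops e_i are
    arbitrary natural numbers and the only constraint left is
    c_(j,k) <= e_(j-1).  In these coordinates the exponents regroup: q_i occurs
    with exponent e_i + ... + e_n, so that the q-part of the weight is the
    product of the Q_l ^ e_l, and the a_j contained in each b_(j,k) contributes
    a factor w ^ (d l) for every unit of e_l.  The weight is thus
      (product over l of (Q_l w^(d l)) ^ e_l) * (product over (j,k) of
      w ^ c_(j,k)),
    the variables separate, and summing over the c_(j,k) gives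
      D = product over l < n of G_d(Q_l w^(d l)), times G_0(Q_n w^(d n)),
    where G_d(x) is the sum over e >= 0 of x^e [e+1]^d, with
    [m] = 1 + w + ... + w^(m-1).  This is [diamond_weight_steps] and
    [Dgf_eqdeg].

    It remains to see that
      G_d(x) = F_d(x, w) / ((1 - x) (1 - x w) ... (1 - x w^d)).
    Since (1 - w) [e+1] = 1 - w^(e+1), one has
      (1 - w) G_(d+1)(x) = G_d(x) - w G_d(x w),
    and clearing denominators turns this into the recursion that defines
    F_(d+1).  The induction, [trunc_qnum_series_eqdeg], can start at d = 0, where
    G_0 is the geometric series, because the recursion applied to the constant
    1 yields F_1 = 1.

    Infinite sums of power series are avoided: all identities are proved between
    finite sums in which the e_i are smaller than b, and only for the
    coefficients of total degree smaller than b.  As b is arbitrary, this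
    determines every coefficient. *)

(** * Power sums of q-numbers *)

Definition qnum {S : comNzRingType} (w : S) (m : nat) : S := \sum_(i < m) w ^+ i.

(** The terms x^e of exponent e < b of the series G_d(x). *)
Definition trunc_qnum_series {S : comNzRingType} (d b : nat) (x w : S) : S :=
  \sum_(e < b) x ^+ e * qnum w e.+1 ^+ d.

Lemma qnumE (S : comNzRingType) (w : S) m : (1 - w) * qnum w m = 1 - w ^+ m.
Proof. by rewrite -[RHS]opprB subrX1 -mulNr opprB. Qed.

Lemma trunc_qnum_series0 (S : comNzRingType) b (x w : S) :
  (1 - x) * trunc_qnum_series 0 b x w = 1 - x ^+ b.
Proof.
rewrite -qnumE; congr (_ * _); apply: eq_bigr => e _.
by rewrite expr0 mulr1.
Qed.

(** One of the d.+1 factors [e+1] is replaced by (1 - w^(e+1)) / (1 - w), and the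
    w^e is absorbed in x^e.  The truncation is at the same b on both sides, so
    the identity is exact. *)
Lemma trunc_qnum_seriesS (S : comNzRingType) d b (x w : S) :
  (1 - w) * trunc_qnum_series d.+1 b x w =
  trunc_qnum_series d b x w - w * trunc_qnum_series d b (x * w) w.
Proof.
rewrite /trunc_qnum_series !mulr_sumr -sumrB; apply: eq_bigr => e _.
transitivity (x ^+ e * qnum w e.+1 ^+ d * ((1 - w) * qnum w e.+1)).
  by rewrite exprS; ring.
by rewrite qnumE exprMn exprS; ring.
Qed.

(** * The recursion of the numerators *)

(** Convertible to [biv_eval], in a form whose morphism structure is inferred. *)
Definition biv_morph {S : comNzRingType} (x w : S) :
    {rmorphism {poly {poly int}} -> S} :=
  horner_eval w \o map_poly (horner_eval x \o map_poly intr).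

Lemma biv_eval1 (S : comNzRingType) (x w : S) : biv_eval 1 x w = 1.
Proof. exact: (rmorph1 (biv_morph x w)). Qed.

(** The recursion of F_d evaluated at a point of any commutative ring.  It also
    holds for d = 0, with F_0 = 1, since
    (1 - x w) - w (1 - x) = 1 - w. *)
Lemma biv_eval_FpolyS (S : comNzRingType) d (x w : S) :
  (1 - w) * biv_eval (Fpoly d.+1) x w =
  (1 - x * w ^+ d.+1) * biv_eval (Fpoly d) x w -
  w * (1 - x) * biv_eval (Fpoly d) (x * w) w.
Proof.
pose phi := biv_morph x w.
have phiE p : biv_eval p x w = phi p by [].
have phiX : phi 'X = w by rewrite /phi /= map_polyX /horner_eval hornerX.
have phiC : phi 'X%:P = x.
  by rewrite /phi /= map_polyC /= map_polyX /horner_eval hornerC hornerX.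
case: d => [|d]; first by rewrite /= !biv_eval1; ring.
have /(congr1 phi) := FpolyS (isT : (0 < d.+1)%N).
rewrite /Fnum biv_eval_id rmorphB !rmorphM !rmorphB (rmorphM _ 'X%:P) rmorphXn.
by rewrite rmorph_biv_eval (rmorphM _ 'X%:P) !rmorph1 phiX phiC phiE => ->.
Qed.

(** * Congruence of power series up to a given degree *)

Definition eqdeg {n : nat} {R : comNzRingType} (b : nat) (f g : fps n R) : Prop :=
  forall m : 'X_{1..n}, (mdeg m < b)%N -> fcoef f m = fcoef g m.

Lemma eqdegB n (R : comNzRingType) b (f f' g g' : fps n R) :
  eqdeg b f f' -> eqdeg b g g' -> eqdeg b (f - g) (f' - g').
Proof. by move=> ef eg m mb; rewrite !fcoefD !fcoefN ef ?eg. Qed.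

Lemma eqdegM n (R : comNzRingType) b (f f' g g' : fps n R) :
  eqdeg b f f' -> eqdeg b g g' -> eqdeg b (f * g) (f' * g').
Proof.
move=> ef eg m mb; apply: eq_fcoefM => k km; [apply: ef|apply: eg];
  exact: leq_ltn_trans mb.
Qed.

Lemma eqdeg_prod n (R : comNzRingType) b (I : finType) (f g : I -> fps n R) :
  (forall i, eqdeg b (f i) (g i)) -> eqdeg b (\prod_i f i) (\prod_i g i).
Proof.
by move=> efg; elim/big_rec2: _ => // i p q _ epq; apply: eqdegM.
Qed.

Lemma eqdeg_divr n (R : comNzRingType) b (u f g : fps n R) :
  u \is a GRing.unit -> eqdeg b (f * u) g -> eqdeg b f (g / u).
Proof. by move=> uu efg; rewrite -[f](mulrK uu); apply: eqdegM. Qed.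

Lemma fcoef0M n (R : comNzRingType) (f g : fps n R) :
  fcoef f 0%MM = 0 -> fcoef (f * g) 0%MM = 0.
Proof.
move=> f0; have -> : 0 = fcoef (0 * g) 0%MM by rewrite mul0r.
apply: eq_fcoefM => // k; rewrite mdeg0 leqn0 mdeg_eq0 => /eqP ->.
by rewrite f0.
Qed.

Lemma fps_unit1B n (R : comNzRingType) (f : fps n R) :
  fcoef f 0%MM = 0 -> 1 - f \is a GRing.unit.
Proof.
by move=> f0; apply: fps_unit1; rewrite fcoefD fcoefN fcoef1 f0 eqxx subr0.
Qed.

(** The closed form of G_d, by induction on d.  Of the denominator at d.+1, the
    factor j = d.+1 is the one missing in that of G_d(x), and the factor j = 0 is
    the one missing in that of G_d(x w): they produce the two coefficients in
    the recursion of F_d.  The division by 1 - w is legitimate because w has no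
    constant term; that x has none makes x^b negligible in degrees below b. *)
Lemma trunc_qnum_series_eqdeg n (R : comNzRingType) d b (x w : fps n R) :
    fcoef x 0%MM = 0 -> fcoef w 0%MM = 0 ->
  eqdeg b (trunc_qnum_series d b x w * \prod_(j < d.+1) (1 - x * w ^+ j))
          (biv_eval (Fpoly d) x w).
Proof.
move=> x0 w0; elim: d x x0 => [|d IHd] x x0.
  rewrite big_ord1 mulr1 mulrC trunc_qnum_series0 biv_eval1 => m mb.
  by rewrite fcoefD fcoefN fcoefX_small // subr0.
have u1w := fps_unit1B _ _ _ w0.
rewrite -[biv_eval _ _ _](mulrK u1w) [_ * (1 - w)]mulrC biv_eval_FpolyS.
apply: eqdeg_divr => //; set P := \prod_(j < _) _.
have xw0 : fcoef (x * w) 0%MM = 0 by apply: fcoef0M.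
have -> : trunc_qnum_series d.+1 b x w * P * (1 - w) =
   (1 - x * w ^+ d.+1) *
     (trunc_qnum_series d b x w * \prod_(j < d.+1) (1 - x * w ^+ j)) -
   w * (1 - x) *
     (trunc_qnum_series d b (x * w) w * \prod_(j < d.+1) (1 - x * w * w ^+ j)).
  rewrite mulrC mulrA trunc_qnum_seriesS mulrBl.
  congr (_ - _); rewrite /P.
    by rewrite big_ord_recr /=; ring.
  rewrite big_ord_recl /= expr0 mulr1.
  under eq_bigr => j _ do rewrite exprS mulrA.
  by ring.
by apply: eqdegB; apply: eqdegM => //; apply: IHd.
Qed.

(** * Diamonds and their drops *)

Definition tail_sum {n : nat} (e : {ffun 'I_n.+1 -> nat}) (i : nat) : nat :=
  (\sum_(l < n.+1 | i <= l) e l)%N.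

(** The diamond with drops e and c.  Its second component uses the tail at
    p.1.+1 because a row index j in 'I_n stands for j + 1, so that the lower
    bound a_j of that row is the entry of index p.1.+1. *)
Definition diamond_of_steps {d n : nat} (e : {ffun 'I_n.+1 -> nat})
    (c : {ffun 'I_n * 'I_d -> nat}) :
    {ffun 'I_n.+1 -> nat} * {ffun 'I_n * 'I_d -> nat} :=
  ([ffun i : 'I_n.+1 => tail_sum e i],
   [ffun p : 'I_n * 'I_d => (tail_sum e p.1.+1 + c p)%N]).

Lemma tail_sum_recl n (e : {ffun 'I_n.+1 -> nat}) (i : 'I_n.+1) :
  tail_sum e i = (e i + tail_sum e i.+1)%N.
Proof.
rewrite /tail_sum (bigD1 i) //=; congr addn; apply: eq_bigl => l.
by rewrite ltn_neqAle andbC eq_sym.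
Qed.

Lemma tail_sum_end n (e : {ffun 'I_n.+1 -> nat}) : tail_sum e n.+1 = 0%N.
Proof. by rewrite /tail_sum big1 // => l; rewrite leqNgt ltn_ord. Qed.

Lemma diamond_of_steps_inj d n (e e' : {ffun 'I_n.+1 -> nat})
    (c c' : {ffun 'I_n * 'I_d -> nat}) :
  diamond_of_steps e c = diamond_of_steps e' c' -> e = e' /\ c = c'.
Proof.
case=> /ffunP ea /ffunP eb.
have et i : (i <= n.+1)%N -> tail_sum e i = tail_sum e' i.
  rewrite leq_eqVlt => /orP[/eqP ->|lt_in]; first by rewrite !tail_sum_end.
  by have := ea (Ordinal lt_in); rewrite !ffunE.
split; apply/ffunP => i.
  have := et i; rewrite !tail_sum_recl et ?ltn_ord // => /(_ (ltnW (ltn_ord _))).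
  by move/addIn.
by have := eb i; rewrite !ffunE (et _ (leqW (ltn_ord i.1))) => /addnI.
Qed.

Lemma diamond_of_stepsP d n (e : {ffun 'I_n.+1 -> nat})
    (c : {ffun 'I_n * 'I_d -> nat}) :
  (forall j k, c (j, k) <= e (widen_ord (leqnSn n) j))%N ->
  is_diamond (diamond_of_steps e c).
Proof.
move=> ce j k; rewrite !ffunE /= leq_addr; split=> //.
have := tail_sum_recl n e (widen_ord (leqnSn n) j) => /= ->.
by rewrite addnC leq_add2r.
Qed.

(** This is where d > 0 matters: the inequality a_(j-1) >= a_j holds only
    through some b_(j,k) in between. *)
Lemma diamond_of_steps_onto d n ab : (0 < d)%N -> @is_diamond d n ab ->
  exists (e : {ffun 'I_n.+1 -> nat}) (c : {ffun 'I_n * 'I_d -> nat}),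
    (forall j k, c (j, k) <= e (widen_ord (leqnSn n) j))%N /\
    diamond_of_steps e c = ab.
Proof.
case: ab => a y d0 aby.
(* The default 0 acts as an entry of index n + 1, so that e_n = a_n. *)
pose e := [ffun l : 'I_n.+1 =>
  (a l - (if insub l.+1 is Some l' then a l' else 0))%N].
pose c := [ffun p : 'I_n * 'I_d => (y p - a (lift ord0 p.1))%N].
have insubE (j : 'I_n) : insub j.+1 = Some (lift ord0 j : 'I_n.+1).
  have lt_j : (j.+1 < n.+1)%N by apply: ltn_ord j.
  by rewrite (insubT (fun i => i < n.+1)%N lt_j); congr Some; apply: val_inj.
have antia (j : 'I_n) : (a (lift ord0 j) <= a (widen_ord (leqnSn n) j))%N.
  by have [ya ay] := aby j (Ordinal d0); apply: leq_trans ay ya.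
(* The drops telescope; the induction is downward from i = n. *)
have te k (i : 'I_n.+1) : (n - i <= k)%N -> tail_sum e i = a i.
  elim: k i => [|k IHk] i ik; rewrite tail_sum_recl ffunE.
    have -> : i = ord_max by apply: val_inj => /=; have := ltn_ord i; lia.
    by rewrite tail_sum_end insubN ?addn0 ?subn0 //= ltnn.
  have [->|ni] := eqVneq i ord_max.
    by rewrite tail_sum_end insubN ?addn0 ?subn0 //= ltnn.
  have lt_in : (i < n)%N by rewrite ltn_neqAle ni -ltnS ltn_ord.
  have ->: i = widen_ord (leqnSn n) (Ordinal lt_in) by apply: val_inj.
  rewrite insubE -[X in tail_sum e X]/(val (lift ord0 (Ordinal lt_in))).
  have ik' : (n - lift ord0 (Ordinal lt_in) <= k)%N by rewrite lift0 /=; lia.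
  by rewrite (IHk _ ik') subnK // antia.
exists e, c; split=> [j k|].
  by rewrite !ffunE /= insubE; have [] := aby j k; rewrite /=; lia.
congr pair; apply/ffunP; first by move=> i; rewrite !ffunE (te n) ?leq_subr.
move=> [j k]; rewrite !ffunE.
rewrite -[X in tail_sum e X]/(val (lift ord0 j)) (te n) ?leq_subr //.
by rewrite subnKC //; have [] := aby j k.
Qed.

Lemma Qvar_widen n (l : 'I_n.+1) :
  Qvar n l = \prod_(i < n.+1 | (i <= l)%N) qvar n i.
Proof. by rewrite /Qvar (big_ord_widen _ (qvar n) (ltn_ord l)). Qed.

(** Both regroupings exchange a sum over an index with a sum over the tail that
    starts at it: q_i divides Q_l exactly when i <= l, and e_l is counted d times
    for each of the l rows j < l. *)
Lemma diamond_weight_steps d n e c :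
  diamond_weight (diamond_of_steps e c) =
  (\prod_(l < n.+1) (Qvar n l * wvar n ^+ (d * l)) ^+ e l) *
  \prod_(p : 'I_n * 'I_d) wvar n ^+ c p.
Proof.
rewrite /diamond_weight.
have -> : (\sum_(j < n) \sum_(k < d) (diamond_of_steps e c).2 (j, k) =
   \sum_(l < n.+1) d * l * e l + \sum_p c p)%N.
  rewrite pair_bigA /=.
  under eq_bigr => p _ do rewrite ffunE -surjective_pairing.
  rewrite big_split /=; congr addn.
  rewrite -(pair_bigA _ (fun (j : 'I_n) (k : 'I_d) => tail_sum e j.+1)) /=.
  under eq_bigr => j _ do rewrite sum_nat_const card_ord big_distrr /=.
  rewrite (exchange_big_dep xpredT) //=; apply: eq_bigr => l _.
  rewrite sum_nat_const [RHS]mulnAC mulnC; congr muln.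
  rewrite -[RHS]card_ord -!sum1_card.
  rewrite (big_ord_widen _ (fun=> 1%N) (ltnSE (ltn_ord l))).
  by apply: eq_bigl.
rewrite exprD -(prodrXr _ _ _ (fun p => c p)) mulrA; congr (_ * _).
under [RHS]eq_bigr => l _ do rewrite exprMn -exprM.
rewrite big_split /= prodrXr; congr (_ * _).
under [RHS]eq_bigr => l _ do rewrite Qvar_widen -prodrXl.
rewrite (exchange_big_dep xpredT) //=; apply: eq_bigr => i _.
by rewrite ffunE prodrXr.
Qed.

(** The degree of a weight bounds all entries of its diamond, hence all drops,
    so that only finitely many diamonds are relevant in degrees below b. *)
Lemma mdeg_diamond d n ab (m : 'X_{1..n.+2}) :
  fcoef (@diamond_weight d n ab) m != 0 ->
  mdeg m = (\sum_i ab.1 i + \sum_p ab.2 p)%N.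
Proof.
rewrite diamond_weightE /=; case: (m =P _) => [->|_]; last by rewrite eqxx.
move=> _; rewrite mdegD mdegMn mdeg1 mul1n mdeg_sum pair_bigA; congr addn.
  by apply: eq_bigr => i _; rewrite mdegMn mdeg1 mul1n.
by apply: eq_bigr => -[].
Qed.

(** * The generating function as a product *)

Lemma fsbig_reindex_fin (V : nmodType) (I : choiceType) (J : finType)
    (P : set I) (A : pred J) (h : J -> I) (F : I -> V) :
    {in A &, injective h} -> (forall j, A j -> P (h j)) ->
    (forall i, P i -> F i != 0 -> exists2 j, A j & h j = i) ->
  \sum_(i \in P) F i = \sum_(j | A j) F (h j).
Proof.
move=> h_inj hP hF.
rewrite -[RHS]big_filter -(big_map h xpredT F) [RHS]fsbig_seq; last first.
  rewrite map_inj_in_uniq ?filter_uniq ?index_enum_uniq // => j k.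
  by rewrite !mem_filter => /andP[Aj _] /andP[Ak _]; apply: h_inj.
apply/esym/fsbig_widen => [_ /= /mapP[j + ->]|i [Pi] /= nih].
  by rewrite mem_filter => /andP[Aj _]; apply: hP.
apply/eqP; apply/negPn/negP => /(hF _ Pi)[j Aj hj]; apply: nih.
by rewrite -hj map_f // mem_filter Aj mem_index_enum.
Qed.

(** The diamonds of weight of degree below b all have drops smaller than b.  The
    finite product also generates diamonds of larger degree, but each of them
    once, so its coefficients are sums over a subfamily of the diamonds.  The factor l = n carries no q-number, as no row
    follows a_n. *)
Lemma Dgf_eqdeg d n b : (0 < d)%N ->
  eqdeg b (Dgf d n)
    (\prod_(l < n.+1) trunc_qnum_series (if (l < n)%N then d else 0) b
       (Qvar n l * wvar n ^+ (d * l)) (wvar n)).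
Proof.
move=> d0 m mb.
pose nats (I : finType) (f : {ffun I -> 'I_b}) :=
  [ffun i => nat_of_ord (f i)].
pose J := ({ffun 'I_n.+1 -> 'I_b} * {ffun 'I_n * 'I_d -> 'I_b})%type.
pose h (x : J) := diamond_of_steps (nats _ x.1) (nats _ x.2).
pose A (x : J) := x.2 \in
  family (fun p => [pred c : 'I_b | (c <= x.1 (widen_ord (leqnSn n) p.1))%N]).
have nats_inj I : injective (nats I).
  move=> f g /ffunP fg; apply/ffunP => i; apply: val_inj.
  by have := fg i; rewrite !ffunE.
have -> : fcoef (Dgf d n) m = \sum_(x | A x) fcoef (diamond_weight (h x)) m.
  apply: fsbig_reindex_fin => [[e c] [e' c'] _ _|[e c] Ax|ab Pab].
  - by case/diamond_of_steps_inj => /nats_inj /= -> /nats_inj /= ->.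
  - apply: diamond_of_stepsP => j k; rewrite !ffunE.
    by have /familyP/(_ (j, k)) := Ax.
  have [e [c [ce eq_ab]]] := diamond_of_steps_onto _ _ _ d0 Pab.
  move/mdeg_diamond => dm.
  have eb l : (e l < b)%N.
    apply: leq_ltn_trans mb; rewrite dm -eq_ab.
    apply: leq_trans (leq_addr _ _); rewrite (bigD1 l) //= ffunE.
    by rewrite tail_sum_recl -!addnA leq_addr.
  have cb p : (c p < b)%N.
    by case: p => j k; apply: leq_ltn_trans (eb (widen_ord (leqnSn n) j)).
  pose x : J := ([ffun l => Ordinal (eb l)], [ffun p => Ordinal (cb p)]).
  have xe : nats _ x.1 = e by apply/ffunP => l; rewrite !ffunE.
  have xc : nats _ x.2 = c by apply/ffunP => p; rewrite !ffunE.
  exists x; last by rewrite /h xe xc.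
  by apply/familyP => -[j k]; rewrite !ffunE; apply: ce.
have fcoef_sum (I : finType) (B : pred I) (f : I -> fps n.+2 int) :
    fcoef (\sum_(i | B i) f i) m = \sum_(i | B i) fcoef (f i) m.
  exact: (big_morph (fun g => fcoef g m)).
(* From here on the two finite sums of power series are equal outright. *)
rewrite -fcoef_sum; congr (fcoef _ m).
rewrite /trunc_qnum_series bigA_distr_bigA /=.
transitivity (\sum_e \sum_(c | A (e, c)) diamond_weight (h (e, c))).
  by rewrite pair_big_dep; apply: eq_big => -[].
apply: eq_bigr => e _; rewrite /A /=.
under eq_bigr => c _ do rewrite diamond_weight_steps /=.
rewrite -mulr_sumr big_split /=; congr (_ * _).
  by apply: eq_bigr => l _; rewrite ffunE.
under eq_bigr => c _ do under eq_bigr => p _ do rewrite ffunE.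
rewrite -(bigA_distr_big_dep _ (fun _ (c : 'I_b) => wvar n ^+ c)) /=.
rewrite [RHS]big_ord_recr /= ltnn expr0 mulr1.
rewrite -(pair_bigA _ (fun (j : 'I_n) (k : 'I_d) =>
   \sum_(c < b | (c <= e (widen_ord (leqnSn n) j))%N) wvar n ^+ c)) /=.
apply: eq_bigr => j _; rewrite ltn_ord prodr_const card_ord; congr (_ ^+ _).
by rewrite /qnum (big_ord_widen _ _ (ltn_ord (e (widen_ord (leqnSn n) j)))).
Qed.

Theorem theorem2p3 (d n : nat) (hd : (1 <= d)%N) (hn : (1 <= n)%N) :
  Dgf d n =
  (\prod_(k < n)
     (biv_eval (Fpoly d) (Qvar n k * wvar n ^+ (d * k)) (wvar n) /
      \prod_(j < d.+1) (1 - Qvar n k * wvar n ^+ (d * k + j)))) *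
  (1 - Qvar n n * wvar n ^+ (d * n))^-1.
Proof.
have w0 : fcoef (wvar n) 0%MM = 0.
  by rewrite /= eq_sym -mdeg_eq0 mdeg1.
have x0 k a : fcoef (Qvar n k * wvar n ^+ a) 0%MM = 0.
  rewrite /Qvar big_ord_recl -mulrA; apply: fcoef0M.
  by rewrite /= eq_sym -mdeg_eq0 mdeg1.
(* The factor of index n is the case d = 0 of the others: F_0 = 1 and the
   denominator is 1 - Q_n w^(d n). *)
pose mult k := if (k < n)%N then d else 0%N.
have main b : eqdeg b (Dgf d n)
    (\prod_(k < n.+1)
       (biv_eval (Fpoly (mult k)) (Qvar n k * wvar n ^+ (d * k)) (wvar n) /
        \prod_(j < (mult k).+1)
          (1 - Qvar n k * wvar n ^+ (d * k) * wvar n ^+ j))).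
  move=> m mb; rewrite (Dgf_eqdeg _ _ _ hd m mb).
  apply: eqdeg_prod mb => k; apply: eqdeg_divr; last exact: trunc_qnum_series_eqdeg.
  by apply: rpred_prod => j _; apply: fps_unit1B; rewrite -mulrA -exprD.
apply/fpsP => m; rewrite (main _ m (ltnSn _)); congr fcoef.
rewrite /mult big_ord_recr /= ltnn biv_eval1 big_ord1 mulr1 mul1r.
congr (_ * _); apply: eq_bigr => k _; rewrite ltn_ord; congr (_ / _).
by apply: eq_bigr => j _; rewrite exprD mulrA.
Qed.
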